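(* Let $X$ be a set. The space $\operatorname{Spec}\mathcal{P}(X)$ together with the map $\eta:X\to\operatorname{Spec}\mathcal{P}(X)$ given by $x\mapsto\mathfrak{m}_x=\mathcal{P}(X\setminus\{x\})$ is the Stone–Čech compactification of the discrete space $X$.
   Context: $\mathcal{P}(X)$ denotes the power set ring of $X$: the set of all subsets of $X$ with addition $A+B=(A\cup B)\setminus(A\cap B)$ and multiplication $A\cdot B=A\cap B$ (zero is $\emptyset$, unit is $X$). $\operatorname{Spec}$ is equipped with the Zariski topology. For $x\in X$, $\mathfrak{m}_x=\mathcal{P}(X\setminus\{x\})$, the set of subsets of $X$ not containing $x$, is a maximal ideal of $\mathcal{P}(X)$. A compact space means a quasi-compact Hausdorff space. The Stone–Čech compactification of a topological space $X$ is a pair $(\beta X,\eta)$ where $\beta X$ is a compact space and $\eta:X\to\beta X$ is a continuous map such that for each pair $(Y,\varphi)$ with $Y$ a compact space and $\varphi:X\to Y$ continuous, there is a unique continuous map $\widetilde\varphi:\beta X\to Y$ with $\varphi=\widetilde\varphi\circ\eta$. *)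

(* Defs.v *)
From HB Require Import structures.
From mathcomp Require Import all_boot all_algebra.
From mathcomp Require Import all_classical topology.

Set Implicit Arguments.
Unset Strict Implicit.
Unset Printing Implicit Defensive.

Import GRing.Theory.
Local Open Scope classical_set_scope.
Local Open Scope ring_scope.

(* When X is empty this is the zero ring, hence comPzRingType rather than
   comNzRingType. *)
Definition powerset_ring (X : Type) : Type := set X.

Section PowersetRing.
Variable X : Type.

HB.instance Definition _ := gen_eqMixin (powerset_ring X).
HB.instance Definition _ := gen_choiceMixin (powerset_ring X).

Definition powerset_add (A B : powerset_ring X) : powerset_ring X :=
  (A `|` B) `\` (A `&` B).
Definition powerset_mul (A B : powerset_ring X) : powerset_ring X := A `&` B.
Definition powerset_opp (A : powerset_ring X) : powerset_ring X := A.

Let addE : powerset_add = @setY X.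
Proof. by apply/funext => A; apply/funext => B; rewrite setYE. Qed.

Let addA : associative powerset_add.
Proof. by rewrite addE; exact: setYA. Qed.

Let addC : commutative powerset_add.
Proof. by rewrite addE; exact: setYC. Qed.

Let add0 : left_id (set0 : powerset_ring X) powerset_add.
Proof. by rewrite addE; exact: set0Y. Qed.

Let addN : left_inverse (set0 : powerset_ring X) powerset_opp powerset_add.
Proof. by rewrite addE => A; exact: setYK. Qed.

HB.instance Definition _ :=
  GRing.isZmodule.Build (powerset_ring X) addA addC add0 addN.

Let mulA : associative powerset_mul. Proof. exact: setIA. Qed.

Let mulC : commutative powerset_mul. Proof. exact: setIC. Qed.

Let mul1 : left_id (setT : powerset_ring X) powerset_mul.
Proof. exact: setTI. Qed.

Let mulD : left_distributive powerset_mul +%R.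
Proof.
move=> A B C; rewrite /GRing.add /= addE; exact: (@setIYl X A B C).
Qed.

HB.instance Definition _ :=
  GRing.Zmodule_isComPzRing.Build (powerset_ring X) mulA mulC mul1 mulD.

End PowersetRing.

Section Spectrum.
Variable R : comPzRingType.

Definition is_ideal (I : set R) : Prop :=
  [/\ I 0, forall a b, I a -> I b -> I (a + b) & forall a b, I b -> I (a * b)].

Definition is_prime_ideal (I : set R) : Prop :=
  [/\ is_ideal I, ~ I 1 & forall a b, I (a * b) -> I a \/ I b].

Record Spec : Type := MkSpec {
  spec_ideal :> set R;
  spec_prime : is_prime_ideal spec_ideal
}.

HB.instance Definition _ := gen_eqMixin Spec.
HB.instance Definition _ := gen_choiceMixin Spec.

Definition zero_locus (E : set R) : set Spec := [set p : Spec | E `<=` p].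

Definition zariski_open (U : set Spec) : Prop :=
  exists E : set R, U = ~` zero_locus E.

Let openT : zariski_open setT.
Proof.
exists [set 1]; rewrite -[LHS]setCK; congr (~` _).
rewrite setCT; apply/seteqP; split=> // p /= p1.
by have [_ p1N _] := spec_prime p; exact/p1N/p1.
Qed.

Let openI : setI_closed zariski_open.
Proof.
move=> _ _ [E ->] [F ->].
exists [set z | exists a b, [/\ E a, F b & z = a * b]].
rewrite -setCU; congr (~` _); apply/seteqP; split=> p /=.
  have [[_ _ pM] _ _] := spec_prime p.
  move=> [pE _ [a [b [Ea Fb ->]]]|pF _ [a [b [Ea Fb ->]]]].
    by rewrite mulrC; exact/pM/pE.
  exact/pM/pF.
move=> pEF; have [_ _ pP] := spec_prime p.
have [pE|/existsNP[a /not_implyP[Ea pa]]] := pselect (E `<=` p); first by left.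
right=> b Fb; have /pP[|//] : spec_ideal p (a * b) by apply: pEF; exists a, b.
by move=> /pa.
Qed.

Let open_bigU (I : Type) (f : I -> set Spec) :
  (forall i, zariski_open (f i)) -> zariski_open (\bigcup_i f i).
Proof.
move=> fop; have /choice[E fE] := fop.
exists (\bigcup_i E i); apply/seteqP; split=> p /=.
  by move=> [i _]; rewrite fE /= => piN pU; apply: piN => a Ea; apply: pU; exists i.
move=> pN; apply: contrapT => pfN; apply: pN => a [i _ Ea].
apply: contrapT => pa; apply: pfN; exists i => //.
by rewrite fE /= => /(_ _ Ea).
Qed.

HB.instance Definition _ :=
  isOpenTopological.Build Spec openT openI open_bigU.

End Spectrum.

Definition point_ideal (X : Type) (x : X) : set (powerset_ring X) :=
  [set A : set X | A `<=` ~` [set x]].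

Lemma point_ideal_prime (X : Type) (x : X) : is_prime_ideal (point_ideal x).
Proof.
have mE (A : set X) : point_ideal x A <-> ~ A x.
  by split=> [Ax /Ax|Ax y Ay /= yx]; [exact | apply: Ax; rewrite -yx].
split; first split.
- exact/mE.
- by move=> A B /mE Ax /mE Bx; apply/mE => -[[]].
- by move=> A B /mE Bx; apply/mE => -[].
- by move=> /mE; apply.
- move=> A B /mE ABx; have [Ax|Ax] := pselect (A x); last by left; exact/mE.
  by right; apply/mE => Bx; exact: ABx.
Qed.

(* {classic X} only equips X with the choiceType structure that
   discrete_topology requires. *)
Definition spec_eta (X : Type) (x : discrete_topology {classic X}) :
    Spec (powerset_ring X) :=
  MkSpec (@point_ideal_prime X x).

Definition compact_space (T : topologicalType) : Prop :=
  compact [set: T] /\ hausdorff_space T.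

Definition is_stone_cech (X B : topologicalType) (eta : X -> B) : Prop :=
  [/\ compact_space B,
      continuous eta &
      forall (Y : topologicalType) (phi : X -> Y),
        compact_space Y -> continuous phi ->
        exists! psi : B -> Y, continuous psi /\ phi = psi \o eta].

(* Main.v *)
Require Import Defs.
From mathcomp Require Import all_boot all_algebra.
From mathcomp Require Import all_classical topology.

(** A prime ideal [p] of [P(X)] and its complement determine each other, and the
complements are exactly the ultrafilters on [X]: of [A] and [X \ A], whose
product is [0] and whose sum is [1], exactly one lies in [p].  So [Spec P(X)] is
the space of ultrafilters on [X], with basic open sets
[D(A) = {p | A is not in p}], each of which is clopen with complement [D(X \ A)].

- [Spec P(X)] is Hausdorff because some [A] lies in exactly one of two distinct
  primes, which [D(A)] and [D(X \ A)] then separate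
  ([spec_powerset_hausdorff]).  It is compact because an ultrafilter [G] on it
  converges to the prime whose ultrafilter is [{A | D(A) in G}]
  ([spec_powerset_compact]).

- Write [F_p] for the ultrafilter complementary to [p].  Since
  [eta^-1(D(A)) = A], the image of [F_p] under [eta] converges to [p]
  ([cvg_spec_eta]).  A continuous [psi] on [Spec P(X)] is therefore forced:
  [psi p] is a limit of [F_p] along [psi \o eta], which is unique in a Hausdorff
  space.

- Conversely, in a compact Hausdorff [Y] the image of [F_p] under [phi] has a
  limit, and taking it as [psi p] gives a continuous map because [Y] is regular
  ([continuous_ultra_limit]). *)

Set Implicit Arguments.
Unset Strict Implicit.
Unset Printing Implicit Defensive.

Import GRing.Theory.
Local Open Scope classical_set_scope.
Local Open Scope ring_scope.

(** If a strictly larger filter had a new member [A], then [F], and so the larger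
filter, would contain [~` A] and the larger one would not be proper. *)
Lemma ultra_of_setVsetC (T : Type) (F : set_system T) :
  ProperFilter F -> (forall A, F A \/ F (~` A)) -> UltraFilter F.
Proof.
move=> FF FC; split=> // G GG FG.
apply/seteqP; split=> // A GA; have [//|/FG GCA] := FC A.
have [] := filter_not_empty G; rewrite -(setICr A); exact: filterI.
Qed.

Lemma fmap_ultra (T U : Type) (f : T -> U) (F : set_system T) :
  UltraFilter F -> UltraFilter (f @ F).
Proof.
move=> FU; have FF := @ultra_proper _ _ FU.
by apply: ultra_of_setVsetC => A; exact: (in_ultra_setVsetC (f @^-1` A) FU).
Qed.

Lemma compact_ultra_cvg (T : topologicalType) (F : set_system T) :
  compact [set: T] -> UltraFilter F -> exists x : T, F --> x.
Proof.
rewrite compact_ultra => cT FU; have FF := @ultra_proper _ _ FU.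
by have [x [_ Fx]] := cT F FU filterT; exists x.
Qed.

Section SpecPowerset.
Variable X : Type.
Implicit Types (p q : Spec (powerset_ring X)) (A B : set X).

(** The ultrafilter corresponding to the prime ideal [p]. *)
Definition spec_filter p : set_system X := [set A | ~ spec_ideal p A].

(** The distinguished open set [D(A)] of the Zariski topology. *)
Definition basic_open A : set (Spec (powerset_ring X)) :=
  [set p | spec_filter p A].

(** Of [A] and its complement, one lies in [p] because their product is [0],
and not both because their sum is [1]. *)
Lemma spec_filterC p A : spec_filter p (~` A) <-> ~ spec_filter p A.
Proof.
have [[p0 pD _] p1 pM] := spec_prime p.
split=> [npCA npA | /contrapT pA pCA].
  have [//||] := pM A (~` A); last by [].
    by rewrite [_ * _](setICr A).
  by move/npA.
apply: p1; suff E : [set: X] = (A `|` ~` A) `\` (A `&` ~` A).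
  by rewrite [1]E; exact: pD.
by rewrite setUv setICr setD0.
Qed.

(** Primality of [p] is closure under intersection, [1] not in [p] is membership
of [setT], and [0] in [p] is properness.  The filter is upward closed because [A]
contained in [B] means [A = A * B], so that the ideal is downward closed. *)
Lemma spec_filter_proper p : ProperFilter (spec_filter p).
Proof.
have [[p0 _ pM] p1 pP] := spec_prime p.
split; first by apply.
split=> // [A B pA pB pAB|A B AB pA pB].
  by have [] := pP A B.
by apply: pA; rewrite -(setIidl AB); exact: (pM A B).
Qed.

#[local] Existing Instance spec_filter_proper.

Lemma spec_filter_ultra p : UltraFilter (spec_filter p).
Proof.
by apply: ultra_of_setVsetC => A; rewrite spec_filterC; exact: EM.
Qed.

(** An inclusion is enough because ultrafilters are maximal, equivalently because
[P(X)] has Krull dimension zero. *)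
Lemma spec_filter_inj p q : spec_filter p `<=` spec_filter q -> p = q.
Proof.
move=> pq; have E : spec_ideal p = spec_ideal q.
  apply/seteqP; split=> A; last by move=> qA; apply: contrapT => /pq.
  move=> pA; have /pq/spec_filterC : spec_filter p (~` A) by apply/spec_filterC; apply.
  exact: contrapT.
case: p q E {pq} => [I Ip] [J Jp] /= E; case: _ / E Jp => Jp.
by congr MkSpec; exact: Prop_irrelevance.
Qed.

Lemma ultra_ideal_prime (F : set_system X) : UltraFilter F ->
  is_prime_ideal ([set A | ~ F A] : set (powerset_ring X)).
Proof.
move=> FU; have FF := @ultra_proper _ _ FU.
split; first split.
- exact: filter_not_empty.
- move=> A B nFA nFB FAB.
  (* [~` A] and [~` B] are in [F] and both miss the symmetric difference. *)
  have [//|FCA] := in_ultra_setVsetC A FU; have [//|FCB] := in_ultra_setVsetC B FU.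
  apply: (filter_not_empty F).
  apply: filterS (filterI FAB (filterI FCA FCB)).
  by move=> x [[[Ax|Bx] _] [nA nB]]; [exact: nA|exact: nB].
- by move=> A B nFB FAB; apply: nFB; apply: filterS FAB => x [].
- by apply; exact: filterT.
- move=> A B nFAB; apply: contrapT => /not_orP[/contrapT FA /contrapT FB].
  exact/nFAB/filterI.
Qed.

Lemma basic_open_open A : open (basic_open A).
Proof.
exists [set A]; apply/seteqP; split=> p /= pA; first by move=> /(_ A erefl).
by move=> pA'; apply: pA => _ ->.
Qed.

(** The complement of the zero locus of [E] is the union of the [basic_open A]
for [A] in [E], so these sets form a basis of the topology. *)
Lemma nbhs_specP p (W : set (Spec (powerset_ring X))) :
  nbhs p W <-> exists2 A, spec_filter p A & basic_open A `<=` W.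
Proof.
split=> [|[A pA AW]].
  rewrite nbhsE => -[U [[E ->] /= pE] UW].
  have /existsNP[A /not_implyP[EA pA]] := pE.
  by exists A => // q qA; apply: UW => /= /(_ A EA).
by apply: filterS AW _; apply: open_nbhs_nbhs; split=> //; exact: basic_open_open.
Qed.

Lemma spec_powerset_hausdorff : hausdorff_space (Spec (powerset_ring X)).
Proof.
move=> p q pq; apply: spec_filter_inj => A pA.
apply: contrapT => /spec_filterC qCA.
have [||r [rA /spec_filterC]] := pq (basic_open A) (basic_open (~` A)).
- by apply/nbhs_specP; exists A.
- by apply/nbhs_specP; exists (~` A).
- exact.
Qed.

(** [A |-> basic_open A] preserves finite intersections and complements, so an
ultrafilter [G] on the spectrum pulls back along it to an ultrafilter [F] on [X].
The prime ideal complementary to [F] lies in [basic_open A] exactly when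
[basic_open A] is in [G], which is what makes [G] converge to it. *)
Lemma spec_powerset_compact : compact [set: Spec (powerset_ring X)].
Proof.
rewrite compact_ultra => G GU _; have GF := @ultra_proper _ _ GU.
pose F : set_system X := [set A | G (basic_open A)].
have FF : ProperFilter F.
  split.
    suff F0 : basic_open set0 = set0 by rewrite /F /= F0; exact: filter_not_empty.
    by apply/seteqP; split=> // p; exact: filter_not_empty.
  split=> [|A B FA FB|A B AB].
  - by apply: (@filterS _ G _ setT) filterT => p _; exact: filterT.
  - by apply: (@filterS _ G) (@filterI _ G _ _ _ FA FB) => p []; exact: filterI.
  - by apply: (@filterS _ G) => p; exact: filterS.
have FU : UltraFilter F.
  apply: ultra_of_setVsetC => A.
  have [|GC] := in_ultra_setVsetC (basic_open A) GU; first by left.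
  by right; apply: filterS GC => p /spec_filterC.
exists (MkSpec (ultra_ideal_prime FU)); split=> // W /nbhs_specP[A /contrapT].
by move=> FA /filterS; apply.
Qed.

(** Density of [X] in its spectrum, in the form that computes limits: the trace
of a basic neighbourhood [basic_open A] of [p] on [X] is [A] itself. *)
Lemma cvg_spec_eta p : @spec_eta X @ spec_filter p --> p.
Proof.
move=> W /nbhs_specP[A pA AW].
apply: (@filterS _ (spec_filter p) _ A) pA => x Ax.
by apply: (AW (@spec_eta X x)) => /(_ x Ax); apply.
Qed.

(** The ultrafilter of [spec_eta x] is the principal one at [x], as it contains
[[set x]].  This is what makes an extension by limits agree with [phi] on [X]. *)
Lemma cvg_spec_filter_eta (Y : topologicalType) (phi : X -> Y) (x : X) :
  phi @ spec_filter (@spec_eta X x) --> phi x.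
Proof.
move=> W /nbhs_singleton Wx.
apply: (@filterS _ (spec_filter _) _ [set x]) => [_ -> //|].
by move=> /(_ x erefl); apply.
Qed.

(** Around a limit [psi p], regularity of the target gives a neighbourhood [V]
with closure inside any prescribed one; for [q] near [p] the filter of [q]
contains the preimage of [V], which puts its limit [psi q] in that closure. *)
Lemma continuous_ultra_limit (Y : topologicalType) (phi : X -> Y)
    (psi : Spec (powerset_ring X) -> Y) : regular_space Y ->
  (forall p, phi @ spec_filter p --> psi p) -> continuous psi.
Proof.
move=> regY psiP p W /regY[V Vp VW]; apply/nbhs_specP.
exists (phi @^-1` V); first exact: psiP.
move=> q qV; apply: VW => U /(psiP q) qU.
by have [x VUx] := filter_ex (filterI qV qU); exists (phi x).
Qed.

(** Both halves rest on uniqueness of limits in [Y]: the extension sends [p] to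
the limit of [phi @ spec_filter p], and any continuous extension must do so
because [@spec_eta X @ spec_filter p] converges to [p]. *)
Lemma spec_powerset_extension (Y : topologicalType) (phi : X -> Y) :
  compact_space Y ->
  exists! psi : Spec (powerset_ring X) -> Y,
    continuous psi /\ phi = psi \o @spec_eta X.
Proof.
move=> [cY hY].
have phi_cvg (p : Spec (powerset_ring X)) :
    exists y : Y, phi @ spec_filter p --> y.
  exact/(compact_ultra_cvg cY)/fmap_ultra/spec_filter_ultra.
have [psi psiP] := choice phi_cvg.
have regY : regular_space Y.
  by move=> y; apply: (compact_regular hY cY); exact: filterT.
exists psi; split=> [|psi' [psi'C phiE]].
  split; first exact: (continuous_ultra_limit regY psiP).
  apply/funext => x /=.
  have pF := spec_filter_proper (@spec_eta X x).
  apply: (cvg_unique hY _ (psiP (spec_eta x))).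
  exact: cvg_spec_filter_eta.
apply/funext => p; have pF := spec_filter_proper p.
apply: (cvg_unique hY (psiP p)).
rewrite phiE; apply: cvg_trans (psi'C p).
exact: (cvg_app psi' (@cvg_spec_eta p)).
Qed.

End SpecPowerset.

Theorem corollary3p8 (X : Type) :
  @is_stone_cech (discrete_topology {classic X}) (Spec (powerset_ring X))
    (@spec_eta X).
Proof.
split.
- by split; [exact: spec_powerset_compact|exact: spec_powerset_hausdorff].
- move=> x W /nbhs_singleton Wx.
  by apply: (@filterS _ (nbhs x) _ [set x]) (discrete_set1 x) => y ->.
- by move=> Y phi cY _; exact: spec_powerset_extension.
Qed.
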